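(* Let $k$ be a field. For $n\ge 7$, the category $\mathcal S(\widetilde n)$ is not locally support finite.
   Context: Let $\widetilde Q$ be the quiver with vertices $i$ and $i'$ ($i\in\mathbb Z$) and arrows $\alpha_i\colon i\to i-1$, $\alpha'_i\colon i'\to(i-1)'$, $\beta_i\colon i'\to i$. $\mathcal S(\widetilde n)$ is the category of finite-dimensional $k$-representations of $\widetilde Q$ satisfying $\beta\alpha'=\alpha\beta$ (all squares), such that all compositions of $n$ arrows $\alpha$, and of $n$ arrows $\alpha'$, are zero, and such that all maps $\beta_i$ are monomorphisms. The support $\operatorname{supp}M$ of a representation $M$ is the set of vertices $z$ with $M_z\ne 0$. The category $\mathcal S(\widetilde n)$ is locally support finite if for each vertex $z$ of $\widetilde Q$ the union $S_z=\bigcup\{\operatorname{supp}M : M \text{ indecomposable in } \mathcal S(\widetilde n),\ M_z\ne 0\}$ is a finite set. *)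

(* Defs.v *)
From HB Require Import structures.
From mathcomp Require Import all_boot all_order all_algebra.
From mathcomp Require Import boolp classical_sets cardinality.

Set Implicit Arguments.
Unset Strict Implicit.
Unset Printing Implicit Defensive.

Import GRing.Theory.
Local Open Scope ring_scope.

(* [inl i] is the vertex i and [inr i] is the vertex i'. *)
Definition vertex : Type := (int + int)%type.

Inductive arrow : Type :=
  | Alpha of int
  | Alpha' of int
  | Beta of int.

Definition source (a : arrow) : vertex :=
  match a with
  | Alpha i => inl i
  | Alpha' i => inr i
  | Beta i => inr i
  end.

Definition target (a : arrow) : vertex :=
  match a with
  | Alpha i => inl (i - 1)
  | Alpha' i => inr (i - 1)
  | Beta i => inl i
  end.

Definition supp_of (k : fieldType) (V : vertex -> vectType k) : set vertex :=
  [set z | {: V z}%VS != 0%VS]%classic.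

(* Each [vectType] is finite-dimensional, so the total dimension is finite
   exactly when the support is. *)
Record rep (k : fieldType) : Type := Rep {
  space :> vertex -> vectType k;
  rmap : forall a : arrow, 'Hom(space (source a), space (target a));
  space_fin : finite_set (supp_of space)
}.

Definition supp (k : fieldType) (M : rep k) : set vertex := supp_of M.

Definition alpha (k : fieldType) (M : rep k) (i : int) :
  'Hom(M (inl i), M (inl (i - 1))) := rmap M (Alpha i).
Definition alpha' (k : fieldType) (M : rep k) (i : int) :
  'Hom(M (inr i), M (inr (i - 1))) := rmap M (Alpha' i).
Definition beta (k : fieldType) (M : rep k) (i : int) :
  'Hom(M (inr i), M (inl i)) := rmap M (Beta i).

(* [i - n], written as an iterated predecessor so that the composites below
   typecheck without casts. *)
Fixpoint lower (n : nat) (i : int) : int :=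
  if n is m.+1 then lower m (i - 1) else i.

Fixpoint alpha_comp (k : fieldType) (M : rep k) (n : nat) (i : int) :
    'Hom(M (inl i), M (inl (lower n i))) :=
  match n with
  | 0%N => \1%VF
  | m.+1 => (alpha_comp M m (i - 1) \o alpha M i)%VF
  end.

Fixpoint alpha'_comp (k : fieldType) (M : rep k) (n : nat) (i : int) :
    'Hom(M (inr i), M (inr (lower n i))) :=
  match n with
  | 0%N => \1%VF
  | m.+1 => (alpha'_comp M m (i - 1) \o alpha' M i)%VF
  end.

(* The objects of S(n~), a full subcategory of the category of
   representations. *)
Record in_S (k : fieldType) (n : nat) (M : rep k) : Prop := InS {
  S_square : forall i : int,
    (beta M (i - 1) \o alpha' M i)%VF = (alpha M i \o beta M i)%VF;
  S_alpha : forall i : int, alpha_comp M n i = 0;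
  S_alpha' : forall i : int, alpha'_comp M n i = 0;
  S_mono : forall i : int, injective (beta M i)
}.

Definition is_morphism (k : fieldType) (M N : rep k)
    (f : forall z : vertex, 'Hom(M z, N z)) : Prop :=
  forall a : arrow,
    (f (target a) \o rmap M a)%VF = (rmap N a \o f (source a))%VF.

Definition isomorphic (k : fieldType) (M N : rep k) : Prop :=
  exists (f : forall z : vertex, 'Hom(M z, N z))
         (g : forall z : vertex, 'Hom(N z, M z)),
    [/\ is_morphism f, is_morphism g,
        forall z, (g z \o f z)%VF = \1%VF &
        forall z, (f z \o g z)%VF = \1%VF].

Definition is_zero (k : fieldType) (M : rep k) : Prop :=
  supp M = set0.

Section DirectSum.

Variables (k : fieldType).

Section PairMap.

Variables (U V U' V' : vectType k) (f : 'Hom(U, V)) (g : 'Hom(U', V')).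

Definition pair_fun (p : U * U') : V * V' := (f p.1, g p.2).

Fact pair_fun_linear : linear pair_fun.
Proof. by move=> a p q; rewrite /pair_fun /= !linearP. Qed.

HB.instance Definition _ :=
  GRing.isLinear.Build k (U * U')%type (V * V')%type _ pair_fun pair_fun_linear.

Definition pair_map : 'Hom((U * U')%type, (V * V')%type) := linfun pair_fun.

Lemma pair_mapE (p : U * U') : pair_map p = (f p.1, g p.2).
Proof. by rewrite /pair_map lfunE. Qed.

End PairMap.

Variables (M N : rep k).

Definition dsum_space (z : vertex) : vectType k := (M z * N z)%type.

Fact dsum_fin : finite_set (supp_of dsum_space).
Proof.
have sub : (supp_of dsum_space `<=` supp M `|` supp N)%classic.
  move=> z /= nz; case: (pselect (supp M z)) => [|/negP]; first by left.
  rewrite negbK => /eqP M0; right; apply: contra nz => /eqP N0.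
  rewrite -subv0; apply/subvP => -[u v] _; rewrite memv0; apply/eqP.
  have: u \in {: M z}%VS by rewrite memvf.
  have: v \in {: N z}%VS by rewrite memvf.
  by rewrite M0 N0 !memv0 => /eqP -> /eqP ->.
by apply: sub_finite_set sub _; rewrite finite_setU; split; apply: space_fin.
Qed.

Definition dsum : rep k :=
  @Rep k dsum_space (fun a => pair_map (rmap M a) (rmap N a)) dsum_fin.

End DirectSum.

Definition indecomposable (k : fieldType) (n : nat) (M : rep k) : Prop :=
  [/\ in_S n M,
      ~ is_zero M &
      forall X Y : rep k, in_S n X -> in_S n Y ->
        isomorphic M (dsum X Y) -> is_zero X \/ is_zero Y].

(* The union is spelled out rather than written with [\bigcup], because [set]
   cannot be applied to the large type [rep k]. *)
Definition supp_union (k : fieldType) (n : nat) (z : vertex) : set vertex :=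
  [set w | exists M : rep k, [/\ indecomposable n M, supp M z & supp M w]]%classic.

Definition locally_support_finite (k : fieldType) (n : nat) : Prop :=
  forall z : vertex, finite_set (supp_union k n z).

(* Main.v *)
Require Import Defs.
From mathcomp Require Import all_boot all_order all_algebra.
From HB Require Import structures.
From mathcomp Require Import boolp classical_sets cardinality.
From mathcomp Require Import zify.

Set Implicit Arguments.
Unset Strict Implicit.
Unset Printing Implicit Defensive.

Import Order.TTheory GRing.Theory Num.Theory.
Local Open Scope ring_scope.

(** An object of S(n~) is a graded k[T]-module V (the vertices i, with T acting
as alpha), killed by T^n, together with a graded submodule U (the vertices i'
and beta).  Here V is a direct sum of interval modules: [lo, hi] stands for the
module that is one-dimensional in the degrees lo, ..., hi, with T lowering the
degree by one.  For each N, consider the chain of intervals, for 0 <= i <= N,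

   in V:  x_i = [i, i+6],  y_i = [i+1, i+5],  z_i = [i+2, i+3],
   in U:  p_i = [i, i+4],  q_i = [i+1, i+2],

with the inclusion p_i |-> x_i + y_i + z_(i+1) and q_i |-> y_i + z_i in each
degree where the target lives.  The intervals have length at most 7, so T^n is
zero as soon as n >= 7, and the object is nonzero at both vertices 0 and N.
Hence it suffices that it is indecomposable: then every vertex N lies in the
union of supports at the vertex 0.

For indecomposability it is enough that each endomorphism e has only one
eigenvalue, since the projection to a proper summand has the eigenvalues 0 and 1
([single_eigenvalue_indecomposable]).  A homomorphism between interval modules
is multiplication by one scalar, and it can be nonzero from [a, b] to [c, d]
only if a <= c <= b <= d ([entry_coef], [coef_neq0]).  So e is triangular for
the order of the end points, and its eigenvalues are the diagonal coefficients
([eigenvalue_coef]).  Compare the coefficients at g of e(h) for g in V and h in U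
that are incident, that is, g occurs in the image of h.  No other interval
contributes, because the end points are arranged so that distinct intervals
incident to a common one are strictly nested, hence without nonzero homomorphisms
between them ([coef_incident], [coef_glue]).  So e has the same diagonal coefficient at g and
at h.  The incidence graph is connected, being the zigzag

   z_0 - q_0 - y_0 - p_0 - z_1 - q_1 - y_1 - p_1 - z_2 - ...

with x_i attached to p_i, so all diagonal coefficients agree. *)

(** * Interval modules in coordinates *)

Record intervals : Type := Intervals {
  index :> finType;
  lo : index -> int;
  hi : index -> int
}.

Definition live (I : intervals) (t : int) (i : I) : bool := lo i <= t <= hi i.

Section IntervalModule.

Variable k : fieldType.

Definition ispace (I : intervals) (t : int) : vectType k :=
  {ffun {i : I | live t i} -> k^o}.

(** Vectors of degree [t] are handled through functions on all intervals, by this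
restriction and by the extension by zero [coord], so that one matrix indexed by
intervals acts in every degree. *)
Definition crop (I : intervals) (t : int) (F : I -> k) : ispace I t :=
  [ffun s => F (val s)].

Section Coordinates.

Variables (I : intervals) (t : int).
Implicit Types (u v : ispace I t) (i : I).

Definition coord v i : k := if insub i is Some s then v s else 0.

Lemma coord_crop F i : coord (crop t F) i = if live t i then F i else 0.
Proof. by rewrite /coord; case: insubP => [s -> si|/negbTE->//]; rewrite ffunE si. Qed.

Lemma coord_dead v i : ~~ live t i -> coord v i = 0.
Proof. by rewrite /coord; case: insubP => // s ->. Qed.

Lemma coord_inj u v : coord u =1 coord v -> u = v.
Proof.
move=> uv; apply/ffunP => s; have := uv (val s).
by rewrite /coord valK.
Qed.

Lemma coord_linear a u v i : coord (a *: u + v) i = a * coord u i + coord v i.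
Proof. by rewrite /coord; case: insubP => [s _ _|_]; rewrite ?ffunE // mulr0 addr0. Qed.

Lemma coord0 i : coord 0 i = 0.
Proof. by rewrite /coord; case: insubP => // s _ _; rewrite ffunE. Qed.

Lemma coordZ a u i : coord (a *: u) i = a * coord u i.
Proof. by rewrite -[a *: u]addr0 coord_linear coord0 addr0. Qed.

Lemma coord_sum (J : finType) (c : J -> k) (w : J -> ispace I t) i :
  coord (\sum_j c j *: w j) i = \sum_j c j * coord (w j) i.
Proof.
apply: (big_ind2 (fun u a => coord u i = a)) => [|u a v b ua vb|j _].
- exact: coord0.
- by rewrite -[u]scale1r coord_linear mul1r ua vb.
- exact: coordZ.
Qed.

Definition unit_at i : ispace I t := crop t (fun j => (j == i)%:R).

Lemma unit_at_dead i : ~~ live t i -> unit_at i = 0.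
Proof.
move=> it; apply: coord_inj => j; rewrite coord_crop coord0.
by have [->|_] := eqVneq j i; [rewrite (negbTE it) | rewrite if_same].
Qed.

Lemma unit_expansion v : v = \sum_i coord v i *: unit_at i.
Proof.
apply: coord_inj => j; rewrite coord_sum (bigD1 j) //= big1 => [|i /negbTE ij].
  rewrite coord_crop eqxx addr0; case: ifP => [|/negbT jt]; first by rewrite mulr1.
  by rewrite coord_dead // mul0r.
by rewrite coord_crop eq_sym ij if_same mulr0.
Qed.

Lemma ispace_neq0 i : live t i -> {: ispace I t}%VS != 0%VS.
Proof.
move=> it; apply/negP => /eqP V0.
have : unit_at i \in {: ispace I t}%VS by rewrite memvf.
rewrite V0 memv0 => /eqP /(congr1 (coord^~ i)).
by rewrite coord_crop it coord0 eqxx => /eqP; rewrite oner_eq0.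
Qed.

End Coordinates.

Section MatrixMap.

Variables (I J : intervals) (s t : int) (A : J -> I -> k).

Definition matrix_fun (v : ispace I s) : ispace J t :=
  crop t (fun j => \sum_i A j i * coord v i).

Fact matrix_fun_linear : linear matrix_fun.
Proof.
move=> a u v; apply: coord_inj => j; rewrite coord_linear !coord_crop.
case: ifP => _; last by rewrite mulr0 addr0.
rewrite mulr_sumr -big_split; apply: eq_bigr => i _ /=.
by rewrite coord_linear mulrDr mulrCA.
Qed.

HB.instance Definition _ :=
  GRing.isLinear.Build k (ispace I s) (ispace J t) _ matrix_fun matrix_fun_linear.

Definition matrix_map : 'Hom(ispace I s, ispace J t) := linfun matrix_fun.

Lemma coord_matrix_map v j :
  coord (matrix_map v) j = if live t j then \sum_i A j i * coord v i else 0.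
Proof. by rewrite lfunE /= coord_crop. Qed.

End MatrixMap.

Definition shift (I : intervals) (t : int) : 'Hom(ispace I t, ispace I (t - 1)) :=
  matrix_map t (t - 1) (fun j i => (i == j)%:R).

Lemma coord_shift (I : intervals) t (v : ispace I t) i :
  coord (shift I t v) i = if live (t - 1) i then coord v i else 0.
Proof.
rewrite coord_matrix_map (bigD1 i) //= big1 => [|j /negbTE ->]; last by rewrite mul0r.
by rewrite eqxx mul1r addr0.
Qed.

(** * Endomorphisms of a sum of interval modules *)

Section Endomorphism.

Variables (I : intervals) (e : forall t, 'Hom(ispace I t, ispace I t)).
Hypothesis e_shift : forall t, (e (t - 1) \o shift I t)%VF = (shift I t \o e t)%VF.

Definition entry t (i j : I) : k := coord (e t (unit_at t i)) j.

(** An interval module is generated in its top degree [hi i]. *)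
Definition coef (i j : I) : k := entry (hi i) i j.

Lemma coord_endo t v j :
  coord (e t v) j = \sum_i coord v i * entry t i j.
Proof.
rewrite {1}[v]unit_expansion linear_sum /= -coord_sum.
by congr coord; apply: eq_bigr => i _; rewrite linearZ.
Qed.

(** The endomorphism commutes with T, which sends the basis vector of [i] in
degree [t] to the one in degree [t - 1]. *)
Lemma entry_pred t i j : live t i ->
  entry (t - 1) i j = if live (t - 1) j then entry t i j else 0.
Proof.
move=> it; rewrite /entry -coord_shift.
have /lfunP /(_ (unit_at t i)) := e_shift t; rewrite !comp_lfunE => <-.
congr (coord (e _ _) _); apply: coord_inj => l.
rewrite coord_shift !coord_crop; case: ifP => // _.
by have [->|_] := eqVneq l i; rewrite ?it // if_same.
Qed.

(** Descend from the top degree of [i] by [entry_pred]; an interval [j] alive at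
both ends of the descent is alive throughout. *)
Lemma entry_coef t i j : live t i -> entry t i j = if live t j then coef i j else 0.
Proof.
move=> it; pose m := `|hi i - t|%N.
have -> : t = hi i - m%:Z by rewrite /m; move: it; rewrite /live; lia.
have : live (hi i - m%:Z) i by rewrite /m; move: it; rewrite /live; lia.
elim: m => [|m IH] im.
  rewrite subr0; case: ifP => // /negbT; exact: coord_dead.
have im' : live (hi i - m%:Z) i by move: im; rewrite /live; lia.
have -> : hi i - m.+1%:Z = hi i - m%:Z - 1 by lia.
rewrite entry_pred // IH //; case: ifP => // jm.
case: ifP => // jm'; rewrite /coef /entry coord_dead //.
by move: jm jm' im'; rewrite /live; lia.
Qed.

(** The image in [j] of the generator of [i] must live in degree [hi i], and it
must be killed when T carries the generator out of [i] below [lo i]. *)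
Lemma coef_neq0 i j : coef i j != 0 -> [/\ lo i <= lo j, lo j <= hi i & hi i <= hi j].
Proof.
move=> ij.
have jt : live (hi i) j by apply: contraNT ij => /coord_dead; rewrite /coef /entry => ->.
have it : lo i <= hi i.
  apply: contraNT ij => it; rewrite /coef /entry unit_at_dead ?linear0 ?coord0 //.
  by move: it; rewrite /live; lia.
have [jl] : lo j <= hi i /\ hi i <= hi j by apply/andP.
move=> jh; split=> //; apply: contraNT ij => lij.
have il : live (lo i) i by rewrite /live lexx.
(* If lo j < lo i, then j is still alive in degree lo i - 1, where i is dead. *)
have := entry_pred j il; rewrite {1}/entry unit_at_dead ?linear0 ?coord0; last first.
  by rewrite /live; lia.
rewrite entry_coef // !ifT; first by move=> <-.
  by rewrite /live; lia.
by rewrite /live; lia.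
Qed.

(** In an eigenvector take an interval [i] of its support with minimal end points:
by triangularity no other interval of the support maps to [i], so the coordinate
at [i] is multiplied by the diagonal coefficient. *)
Lemma eigenvalue_coef (c : k) t v (l : k) :
    (forall i j : I, lo i = lo j -> hi i = hi j -> i = j) ->
    (forall i, live t i -> coef i i = c) ->
  v != 0 -> e t v = l *: v -> l = c.
Proof.
move=> I_inj diag v0 ev.
have [i0 vi0] : exists i, coord v i != 0.
  apply/existsP; apply: contraNT v0 => /existsPn v0.
  by apply/eqP/coord_inj => i; rewrite coord0; apply/eqP; have := v0 i; rewrite negbK.
have [i vi i_min] := @arg_minP _ _ I i0 (fun i => coord v i != 0) (fun i => lo i + hi i) vi0.
have it : live t i by apply: contraNT vi => /coord_dead ->.
apply: (mulIf vi); rewrite -coordZ -ev coord_endo (bigD1 i) //= big1 ?addr0.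
  by rewrite entry_coef // it diag // mulrC.
move=> j ji; have [-> |vj] := eqVneq (coord v j) 0; first by rewrite mul0r.
have jt : live t j by apply: contraNT vj => /coord_dead ->.
rewrite entry_coef // it; have [->|/coef_neq0 [h1 h2 h3]] := eqVneq (coef j i) 0.
  by rewrite mulr0.
have := i_min j vj => h4; case/eqP: ji; apply: I_inj; move: h1 h2 h3 h4; lia.
Qed.

End Endomorphism.

(** * Objects of S(n~) given by incident intervals *)

Section Submodule.

Variables (U V : intervals) (B : V -> U -> bool).

Definition incl t : 'Hom(ispace U t, ispace V t) :=
  matrix_map t t (fun g h => (B g h)%:R).

Definition irep_space (z : vertex) : vectType k :=
  match z with inl t => ispace V t | inr t => ispace U t end.

Fact ispace_fin (I : intervals) (j : int -> vertex) :
  finite_set [set z | exists t (i : I), z = j t /\ live t i]%classic.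
Proof.
pose s := [seq j (lo i + m%:Z) | i : I <- enum I, m <- iota 0 (`|hi i - lo i|%N).+1].
apply: (sub_finite_set _ (finite_seq s)) => z /= [t [i [-> it]]].
apply/allpairsPdep; exists i, `|t - lo i|%N; split; first by rewrite mem_enum.
  by rewrite mem_iota; move: it; rewrite /live; lia.
by congr j; move: it; rewrite /live; lia.
Qed.

Lemma ispace_live (I : intervals) t : {: ispace I t}%VS != 0%VS -> exists i : I, live t i.
Proof.
move=> V0; apply/existsP; apply: contraNT V0 => /existsPn dead.
rewrite -subv0; apply/subvP => v _; rewrite memv0; apply/eqP/coord_inj => i.
by rewrite coord0 coord_dead.
Qed.

Fact irep_fin : finite_set (supp_of irep_space).
Proof.
have : finite_set ([set z | exists t (i : V), z = inl t /\ live t i] `|`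
                   [set z | exists t (i : U), z = inr t /\ live t i])%classic.
  by rewrite finite_setU; split; [exact: (@ispace_fin V inl) | exact: (@ispace_fin U inr)].
apply: sub_finite_set => -[] t /= /ispace_live [i it]; [left|right]; by exists t, i.
Qed.

Definition irep_map (a : arrow) : 'Hom(irep_space (source a), irep_space (target a)) :=
  match a with
  | Alpha t => shift V t
  | Alpha' t => shift U t
  | Beta t => incl t
  end.

Definition irep : rep k := @Rep k irep_space irep_map irep_fin.

(** The condition for a nonzero homomorphism from the interval [h] to [g]. *)
Hypothesis B_hom : forall g h, B g h -> [/\ lo h <= lo g, lo g <= hi h & hi h <= hi g].

Section InS.

Variable n : nat.
Hypothesis U_short : forall h : U, hi h - lo h < n%:Z.
Hypothesis V_short : forall g : V, hi g - lo g < n%:Z.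
Hypothesis incl_inj : forall t (u : ispace U t), incl t u = 0 -> u = 0.

Lemma lowerE m t : lower m t = t - m%:Z.
Proof. by elim: m t => [|m IH] t /=; rewrite ?IH; lia. Qed.

Lemma coord_alpha_comp m t (v : ispace V t) g :
  coord (alpha_comp irep m t v : ispace V _) g =
    if live (lower m t) g then coord v g else 0.
Proof.
elim: m t v => [|m IH] t v /=.
  by rewrite id_lfunE; case: ifPn => // /coord_dead ->.
rewrite comp_lfunE IH coord_shift lowerE.
case: ifP => // gm; case: ifPn => // gt; rewrite coord_dead //.
by move: gm gt; rewrite /live; lia.
Qed.

Lemma coord_alpha'_comp m t (u : ispace U t) h :
  coord (alpha'_comp irep m t u : ispace U _) h =
    if live (lower m t) h then coord u h else 0.
Proof.
elim: m t u => [|m IH] t u /=.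
  by rewrite id_lfunE; case: ifPn => // /coord_dead ->.
rewrite comp_lfunE IH coord_shift lowerE.
case: ifP => // hm; case: ifPn => // ht; rewrite coord_dead //.
by move: hm ht; rewrite /live; lia.
Qed.

Lemma irep_in_S : in_S n irep.
Proof.
split.
- move=> t; apply/lfunP => u; rewrite !comp_lfunE; apply: coord_inj => g.
  rewrite coord_matrix_map coord_shift coord_matrix_map.
  case: ifP => // gt'; case: ifPn => gt; [apply: eq_bigr|apply: big1] => h _;
    rewrite coord_shift; have [/B_hom [lo_le mid hi_le]|_] := boolP (B g h);
    rewrite ?mul0r // !mul1r; case: ifPn => // ht; rewrite coord_dead //;
    by move: gt gt' ht; rewrite /live; lia.
- move=> t; apply/lfunP => v; apply: (@coord_inj V) => g.
  rewrite coord_alpha_comp lowerE zero_lfunE coord0; case: ifP => // gn.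
  by apply: coord_dead; have := V_short g; move: gn; rewrite /live; lia.
- move=> t; apply/lfunP => u; apply: (@coord_inj U) => h.
  rewrite coord_alpha'_comp lowerE zero_lfunE coord0; case: ifP => // hn.
  by apply: coord_dead; have := U_short h; move: hn; rewrite /live; lia.
- move=> t u w /eqP; rewrite -subr_eq0 -linearB => /eqP /incl_inj /eqP.
  by rewrite subr_eq0 => /eqP.
Qed.

End InS.

Section Diagonal.

Variables (eU : forall t, 'Hom(ispace U t, ispace U t)).
Variables (eV : forall t, 'Hom(ispace V t, ispace V t)).
Hypothesis eU_shift : forall t, (eU (t - 1) \o shift U t)%VF = (shift U t \o eU t)%VF.
Hypothesis eV_shift : forall t, (eV (t - 1) \o shift V t)%VF = (shift V t \o eV t)%VF.
Hypothesis e_incl : forall t, (eV t \o incl t)%VF = (incl t \o eU t)%VF.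

(** Both sides are the coordinate at [g] of the image of the generator of [h]
under the endomorphism: one maps to [V] first and finds [h] split into the
intervals [g'], the other applies the endomorphism in [U] first.  The last two
hypotheses leave a single term on each side. *)
Lemma coef_incident g h : B g h ->
    (forall h', B g h' -> h' != h -> coef eU h h' = 0) ->
    (forall g', B g' h -> g' != g -> coef eV g' g = 0) ->
  coef eV g g = coef eU h h.
Proof.
move=> Bgh onlyU onlyV; have [lo_le mid hi_le] := B_hom Bgh.
have ht : live (hi h) h by rewrite /live; lia.
have gt : live (hi h) g by rewrite /live; lia.
have /lfunP /(_ (unit_at (hi h) h)) := e_incl (hi h); rewrite !comp_lfunE.
have coord_incl g' :
    coord (incl (hi h) (unit_at (hi h) h)) g' = if live (hi h) g' then (B g' h)%:R else 0.
  rewrite coord_matrix_map; case: ifP => // _; rewrite (bigD1 h) //= big1 => [|h' /negbTE hh'].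
    by rewrite coord_crop ht eqxx mulr1 addr0.
  by rewrite coord_crop hh' if_same mulr0.
move=> /(congr1 (fun v => coord v g)).
rewrite coord_endo coord_matrix_map gt (bigD1 g) //= [in RHS](bigD1 h) //= !big1.
- by rewrite coord_incl gt Bgh !mul1r !addr0 -[coord _ h]/(entry eU _ h h) !entry_coef ?ht ?gt.
- move=> h' h'h; have [Bgh'|_] := boolP (B g h'); last by rewrite mul0r.
  by rewrite -[coord _ h']/(entry eU _ h h') entry_coef // onlyU // if_same mulr0.
- move=> g' g'g; rewrite coord_incl; case: ifP => [g't|_]; last by rewrite mul0r.
  have [Bg'h|_] := boolP (B g' h); last by rewrite mul0r.
  by rewrite entry_coef // onlyV // if_same mulr0.
Qed.

End Diagonal.

End Submodule.

End IntervalModule.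

(** * Indecomposability from a single eigenvalue *)

Lemma vect_neq0 (k : fieldType) (W : vectType k) :
  {: W}%VS != 0%VS -> exists w : W, w != 0.
Proof. by move=> W0; exists (vpick {: W}%VS); rewrite vpick0. Qed.

Lemma not_is_zero (k : fieldType) (M : rep k) :
  ~ is_zero M -> exists z, exists v : M z, v != 0.
Proof.
move=> /eqP /set0P [z Mz]; exists z; exact: vect_neq0.
Qed.

(** If M were the sum of nonzero X and Y, the projection to X would be an
endomorphism with eigenvalue 1 on X and 0 on Y. *)
Lemma single_eigenvalue_indecomposable (k : fieldType) (n : nat) (M : rep k) :
    in_S n M -> ~ is_zero M ->
    (forall e : forall z, 'Hom(M z, M z), is_morphism e ->
      exists c : k, forall z (v : M z) l, v != 0 -> e z v = l *: v -> l = c) ->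
  indecomposable n M.
Proof.
move=> MS M0 single; split=> // X Y _ _ [f [g [f_mor g_mor gf fg]]].
have [|/not_is_zero [zx [x x0]]] := pselect (is_zero X); first by left.
have [|/not_is_zero [zy [y y0]]] := pselect (is_zero Y); first by right.
pose pr z : 'Hom(dsum X Y z, dsum X Y z) := pair_map \1%VF 0%VF.
pose e z := (g z \o (pr z \o f z))%VF.
have pr_mor : is_morphism pr.
  move=> a; apply/lfunP => p; rewrite !comp_lfunE !pair_mapE /=.
  by rewrite !id_lfunE !zero_lfunE linear0.
have e_mor : is_morphism e.
  move=> a; rewrite /e -!comp_lfunA (f_mor a) [(pr _ \o (_ \o _))%VF]comp_lfunA pr_mor.
  by rewrite !comp_lfunA (g_mor a).
have fgK z p : f z (g z p) = p by rewrite -comp_lfunE fg id_lfunE.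
have [c e_c] := single e e_mor.
have ev z p : e z (g z p) = g z (p.1, 0).
  by rewrite /e !comp_lfunE fgK pair_mapE id_lfunE zero_lfunE.
have g_neq0 z p : p != 0 -> g z p != 0.
  by apply: contra_neq => gp; rewrite -[p]fgK gp linear0.
have c1 : 1 = c.
  apply: (e_c zx (g zx (x, 0))); last by rewrite ev scale1r.
  by apply: g_neq0; apply: contra_neq x0 => -[].
have c0 : 0 = c.
  apply: (e_c zy (g zy (0, y))); last by rewrite ev scale0r linear0.
  by apply: g_neq0; apply: contra_neq y0 => -[].
by have := oner_neq0 k; rewrite c1 -c0 eqxx.
Qed.

(** * The chain of intervals *)

Section Chain.

Variable N : nat.

Definition ambient : intervals := @Intervals ('I_N.+1 + 'I_N.+1 + 'I_N.+1)%type
  (fun g => match g with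
            | inl (inl i) => i%:Z | inl (inr i) => i%:Z + 1 | inr i => i%:Z + 2 end)
  (fun g => match g with
            | inl (inl i) => i%:Z + 6 | inl (inr i) => i%:Z + 5 | inr i => i%:Z + 3 end).

Definition submod : intervals := @Intervals ('I_N.+1 + 'I_N.+1)%type
  (fun h => match h with inl i => i%:Z | inr i => i%:Z + 1 end)
  (fun h => match h with inl i => i%:Z + 4 | inr i => i%:Z + 2 end).

Definition X (i : 'I_N.+1) : ambient := inl (inl i).
Definition Y (i : 'I_N.+1) : ambient := inl (inr i).
Definition Z (i : 'I_N.+1) : ambient := inr i.
Definition P (i : 'I_N.+1) : submod := inl i.
Definition Q (i : 'I_N.+1) : submod := inr i.

Definition glue (g : ambient) (h : submod) : bool :=
  match g, h with
  | inl (inl i), inl j => i == j :> nat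
  | inl (inr i), inl j => i == j :> nat
  | inr i, inl j => i == j.+1 :> nat
  | inl (inl i), inr j => false
  | inl (inr i), inr j => i == j :> nat
  | inr i, inr j => i == j :> nat
  end.

Lemma glue_hom g h : glue g h -> [/\ lo h <= lo g, lo g <= hi h & hi h <= hi g].
Proof. by case: g h => [[i|i]|i] [j|j] //= /eqP e; split; lia. Qed.

Lemma ambient_inj (g g' : ambient) : lo g = lo g' -> hi g = hi g' -> g = g'.
Proof.
case: g g' => [[i|i]|i] [[j|j]|j] /= e1 e2; try lia;
  by rewrite (_ : i = j) //; apply: val_inj => /=; lia.
Qed.

Lemma submod_inj (h h' : submod) : lo h = lo h' -> hi h = hi h' -> h = h'.
Proof.
case: h h' => [i|i] [j|j] /= e1 e2; try lia;
  by rewrite (_ : i = j) //; apply: val_inj => /=; lia.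
Qed.

Variable k : fieldType.

Definition chain : rep k := irep k glue.

(** The coordinate at [x_i] reads off that of [p_i], and then the coordinate at
[y_i] reads off that of [q_i]; moreover [x_i] and [y_i] are alive wherever
[p_i], respectively [q_i], is. *)
Lemma incl_glue_inj t (u : ispace k submod t) : incl k glue t u = 0 -> u = 0.
Proof.
move=> /(congr1 (fun v => coord v)) u0.
have sum0 g : live t g -> \sum_h (glue g h)%:R * coord u h = 0.
  by move=> gt; have := congr1 (@^~ g) u0; rewrite coord_matrix_map gt coord0.
have uP i : coord u (P i) = 0.
  have [it|/coord_dead ->//] := boolP (live t (P i)).
  have : live t (X i) by move: it; rewrite /live /=; lia.
  move/sum0; rewrite (bigD1 (P i)) //= eqxx mul1r big1 ?addr0 // => -[j|j] ji /=.
    have [/val_inj ij|_] := eqVneq (i : nat) j; last by rewrite mul0r.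
    by rewrite ij eqxx in ji.
  by rewrite mul0r.
apply: coord_inj => -[i|i]; rewrite coord0; first exact: uP.
have [it|/coord_dead ->//] := boolP (live t (Q i)).
have : live t (Y i) by move: it; rewrite /live /=; lia.
move/sum0; rewrite (bigD1 (Q i)) //= eqxx mul1r big1 ?addr0 // => -[j|j] ji /=.
  by rewrite -/(P j) uP mulr0.
have [/val_inj ij|_] := eqVneq (i : nat) j; last by rewrite mul0r.
by rewrite ij eqxx in ji.
Qed.

Lemma chain_in_S n : (7 <= n)%N -> in_S n chain.
Proof.
move=> n7; apply: irep_in_S; [exact: glue_hom | | | exact: incl_glue_inj].
  by move=> [i|i] /=; lia.
by move=> [[i|i]|i] /=; lia.
Qed.

Section Endo.

Variable e : forall z, 'Hom(chain z, chain z).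
Hypothesis e_mor : is_morphism e.

Let eU t : 'Hom(ispace k submod t, ispace k submod t) := e (inr t).
Let eV t : 'Hom(ispace k ambient t, ispace k ambient t) := e (inl t).

(** Any two distinct intervals incident to a common one are strictly nested, so
there is no nonzero homomorphism between them in either direction. *)
Lemma coef_glue g h : glue g h -> coef eV g g = coef eU h h.
Proof.
have eU_shift t := e_mor (Alpha' t).
have eV_shift t := e_mor (Alpha t).
move=> gh; apply: (@coef_incident k submod ambient glue) => //.
- exact: glue_hom.
- by move=> t; exact: (e_mor (Beta t)).
- move=> h' gh' h'h; apply/eqP; apply: contraTT h'h => /(coef_neq0 eU_shift) [l1 l2 l3].
  rewrite negbK; move: gh gh' l1 l2 l3.
  case: g h h' => [[i|i]|i] [j|j] [j'|j'] //= /eqP ij /eqP ij' *; try lia;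
    by apply/eqP; congr (_ _); apply: val_inj => /=; lia.
- move=> g' gh' g'g; apply/eqP; apply: contraTT g'g => /(coef_neq0 eV_shift) [l1 l2 l3].
  rewrite negbK; move: gh gh' l1 l2 l3.
  case: g g' h => [[i|i]|i] [[i'|i']|i'] [j|j] //= /eqP ij /eqP ij' *; try lia;
    by apply/eqP; congr (_ _); try congr (_ _); apply: val_inj => /=; lia.
Qed.

(** One period of the zigzag: p_(m+1) - y_(m+1) - q_(m+1) - z_(m+1) - p_m. *)
Lemma coef_P i : coef eU (P i) (P i) = coef eU (P ord0) (P ord0).
Proof.
case: i => m; elim: m => [|m IH] mN.
  by have -> : Ordinal mN = ord0 by exact: val_inj.
rewrite -(IH (ltnW mN)).
rewrite -(@coef_glue (Y (Ordinal mN)) (P (Ordinal mN))) //=.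
rewrite (@coef_glue _ (Q (Ordinal mN))) //=.
rewrite -(@coef_glue (Z (Ordinal mN)) (Q _)) //=.
by rewrite (@coef_glue _ (P (Ordinal (ltnW mN)))) //=.
Qed.

Lemma coef_ambient g : coef eV g g = coef eU (P ord0) (P ord0).
Proof.
case: g => [[i|i]|i].
- by rewrite (@coef_glue _ (P i)) ?coef_P //=.
- by rewrite (@coef_glue _ (P i)) ?coef_P //=.
- rewrite (@coef_glue _ (Q i)) //= -(@coef_glue (Y i)) //=.
  by rewrite (@coef_glue _ (P i)) ?coef_P //=.
Qed.

Lemma coef_sub h : coef eU h h = coef eU (P ord0) (P ord0).
Proof.
by case: h => i; [exact: coef_P | rewrite -(@coef_glue (Y i)) ?coef_ambient //=].
Qed.

Lemma chain_eigenvalue z (v : chain z) l :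
  v != 0 -> e z v = l *: v -> l = coef eU (P ord0) (P ord0).
Proof.
have eU_shift t := e_mor (Alpha' t).
have eV_shift t := e_mor (Alpha t).
case: z v => t v v0 ev.
  apply: (@eigenvalue_coef k ambient eV _ _ t v) => //; first exact: ambient_inj.
  by move=> g _; exact: coef_ambient.
apply: (@eigenvalue_coef k submod eU _ _ t v) => //; first exact: submod_inj.
by move=> h _; exact: coef_sub.
Qed.

End Endo.

Lemma chain_supp (i : 'I_N.+1) : supp chain (inl i%:Z).
Proof. by apply: (@ispace_neq0 _ _ _ (X i)); rewrite /live /=; lia. Qed.

Lemma chain_indecomposable n : (7 <= n)%N -> indecomposable n chain.
Proof.
move=> n7; apply: single_eigenvalue_indecomposable; first exact: chain_in_S.
  by move=> M0; have := chain_supp ord0; rewrite M0.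
move=> e e_mor; exists (coef (fun t => e (inr t)) (P ord0) (P ord0)) => z v l.
exact: chain_eigenvalue.
Qed.

End Chain.

Theorem mainTheorem12 (k : fieldType) (n : nat) (hn : (7 <= n)%N) :
  ~ locally_support_finite k n.
Proof.
move=> /(_ (inl 0)) fin; apply: infinite_nat.
have inl_inj : {in (fun m : nat => inl m%:Z : vertex) @^-1` supp_union k n (inl 0) &,
    injective (fun m : nat => inl m%:Z : vertex)}%classic.
  by move=> m m' _ _ [].
apply: sub_finite_set (finite_preimage inl_inj fin) => m _ /=.
exists (chain m k); split; first exact: chain_indecomposable.
  exact: (chain_supp k (@ord0 m)).
exact: (chain_supp k (@ord_max m)).
Qed.
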